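(* Let $\mathbf{k}$ be an algebraically closed field, let $\mathcal{C}$ be a finite tensor category over $\mathbf{k}$, let $\mathcal{D}$ be a tensor category over $\mathbf{k}$, and let $F, G: \mathcal{C} \to \mathcal{D}$ be right exact tensor functors. Then the set $\mathrm{Nat}_\otimes(F, G)$ of monoidal natural transformations $F \to G$ is finite.
   Context: A tensor category over $\mathbf{k}$ means a $\mathbf{k}$-linear abelian rigid monoidal category $\mathcal{C}$ such that: the unit object $\mathbf{1} \in \mathcal{C}$ is simple; the tensor product $\otimes: \mathcal{C} \times \mathcal{C} \to \mathcal{C}$ is $\mathbf{k}$-linear in both variables; every object of $\mathcal{C}$ is of finite length; every hom-set in $\mathcal{C}$ is finite-dimensional over $\mathbf{k}$. A $\mathbf{k}$-linear abelian category is finite if it is $\mathbf{k}$-linearly equivalent to the category of finitely generated modules over a finite-dimensional $\mathbf{k}$-algebra; a finite tensor category is a tensor category that is finite in this sense. A tensor functor is a $\mathbf{k}$-linear strong monoidal functor between tensor categories. A monoidal natural transformation is a natural transformation compatible with the monoidal structure morphisms for both tensor products and unit objects. *)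

(* Defs.v *)
From HB Require Import structures.
From mathcomp Require Import all_boot all_algebra all_field.
From mathcomp Require Import boolp.

Set Implicit Arguments.
Unset Strict Implicit.
Unset Printing Implicit Defensive.

Import GRing.Theory.
Local Open Scope ring_scope.

(* Over a field, fin_gen means finite-dimensional. *)
Definition fin_gen (R : pzRingType) (V : lmodType R) : Prop :=
  exists (n : nat) (v : 'I_n -> V),
    forall x : V, exists c : 'I_n -> R, x = \sum_i c i *: v i.

(* compm g f is g after f. *)
Record linCat (k : fieldType) := LinCat {
  cobj :> Type;
  mor : cobj -> cobj -> lmodType k;
  idm : forall X : cobj, mor X X;
  compm : forall X Y Z : cobj, mor Y Z -> mor X Y -> mor X Z;
  compmA : forall (X Y Z W : cobj) (h : mor Z W) (g : mor Y Z) (f : mor X Y),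
    compm h (compm g f) = compm (compm h g) f;
  comp1m : forall (X Y : cobj) (f : mor X Y), compm (idm Y) f = f;
  compm1 : forall (X Y : cobj) (f : mor X Y), compm f (idm X) = f;
  compm_linl : forall (X Y Z : cobj) (f : mor X Y),
    linear (fun g : mor Y Z => compm g f);
  compm_linr : forall (X Y Z : cobj) (g : mor Y Z),
    linear (fun f : mor X Y => compm g f)
}.

Arguments mor {k l} X Y.
Arguments idm {k l} X.
Arguments compm {k l X Y Z} g f.

Declare Scope cat_scope.
Delimit Scope cat_scope with cat.
Notation "g \oc f" := (compm g f)
  (at level 45, left associativity, format "g  \oc  f") : cat_scope.
Local Open Scope cat_scope.

Record linFunctor (k : fieldType) (C D : linCat k) := LinFunctor {
  fobj :> C -> D;
  fmap : forall X Y : C, mor X Y -> mor (fobj X) (fobj Y);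
  fmap1 : forall X : C, fmap (idm X) = idm (fobj X);
  fmapM : forall (X Y Z : C) (g : mor Y Z) (f : mor X Y),
    fmap (g \oc f) = fmap g \oc fmap f;
  fmap_lin : forall X Y : C, linear (@fmap X Y)
}.

Arguments fmap {k C D} F {X Y} f : rename.

Section LinearCategory.
Variables (k : fieldType) (C : linCat k).
Implicit Types X Y Z : C.

Definition inverses X Y (f : mor X Y) (g : mor Y X) : Prop :=
  g \oc f = idm X /\ f \oc g = idm Y.

Definition is_iso X Y (f : mor X Y) : Prop := exists g, inverses f g.

Definition is_mono X Y (f : mor X Y) : Prop :=
  forall W (g h : mor W X), f \oc g = f \oc h -> g = h.

Definition is_epi X Y (f : mor X Y) : Prop :=
  forall W (g h : mor Y W), g \oc f = h \oc f -> g = h.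

Definition is_zero Z : Prop :=
  forall X, (forall f : mor X Z, f = 0) /\ (forall f : mor Z X, f = 0).

Definition is_biproduct X Y S : Prop :=
  exists (i : mor X S) (j : mor Y S) (p : mor S X) (q : mor S Y),
    [/\ p \oc i = idm X, q \oc j = idm Y, q \oc i = 0, p \oc j = 0
      & i \oc p + j \oc q = idm S].

Definition is_kernel K X Y (f : mor X Y) (i : mor K X) : Prop :=
  f \oc i = 0 /\
  forall W (g : mor W X), f \oc g = 0 -> exists! h : mor W K, i \oc h = g.

Definition is_cokernel X Y Q (f : mor X Y) (p : mor Y Q) : Prop :=
  p \oc f = 0 /\
  forall W (g : mor Y W), g \oc f = 0 -> exists! h : mor Q W, h \oc p = g.

Record is_abelian : Prop := IsAbelian {
  abelian_zero : exists Z, is_zero Z;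
  abelian_biproduct : forall X Y, exists S, is_biproduct X Y S;
  abelian_kernel : forall X Y (f : mor X Y),
    exists K (i : mor K X), is_kernel f i;
  abelian_cokernel : forall X Y (f : mor X Y),
    exists Q (p : mor Y Q), is_cokernel f p;
  abelian_mono : forall X Y (i : mor X Y), is_mono i ->
    exists Z (f : mor Y Z), is_kernel f i;
  abelian_epi : forall X Y (p : mor X Y), is_epi p ->
    exists Z (f : mor Z X), is_cokernel f p
}.

Definition is_simple X : Prop :=
  ~ is_zero X /\
  forall Y (i : mor Y X), is_mono i -> is_zero Y \/ is_iso i.

(* X has a composition series: in the second rule, 0 -> Y -> X -> S -> 0 is
   exact, with S the top simple quotient of the series. *)
Inductive finite_length : C -> Prop :=
| finite_length_zero X : is_zero X -> finite_length X
| finite_length_ext X Y S (i : mor Y X) (p : mor X S) :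
    is_kernel p i -> is_cokernel i p -> is_simple S ->
    finite_length Y -> finite_length X.

End LinearCategory.

(* F sends every exact sequence X -> Y -> Q -> 0 to an exact sequence. *)
Definition right_exact (k : fieldType) (C D : linCat k) (F : linFunctor C D)
    : Prop :=
  forall (X Y Q : C) (f : mor X Y) (p : mor Y Q),
    is_cokernel f p -> is_cokernel (fmap F f) (fmap F p).

Definition equivalent (k : fieldType) (C D : linCat k) : Prop :=
  exists (F : linFunctor C D) (G : linFunctor D C)
    (u : forall X : C, mor X (G (F X))) (e : forall Y : D, mor (F (G Y)) Y),
  [/\ forall X, is_iso (u X),
      forall X X' (f : mor X X'), u X' \oc f = fmap G (fmap F f) \oc u X,
      forall Y, is_iso (e Y)
    & forall Y Y' (g : mor Y Y'), g \oc e Y = e Y' \oc fmap F (fmap G g)].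

(* The linear category of finitely generated modules over an algebra A; the
   scalar c : k acts on an A-linear map through the central element c%:A. *)

Definition mod_hom (R : pzRingType) (M N : lmodType R) : Type :=
  {linear M -> N}.

HB.instance Definition _ (R : pzRingType) (M N : lmodType R) :=
  gen_eqMixin (mod_hom M N).
HB.instance Definition _ (R : pzRingType) (M N : lmodType R) :=
  gen_choiceMixin (mod_hom M N).

Lemma mod_homP (R : pzRingType) (M N : lmodType R) (f g : {linear M -> N}) :
  f =1 g -> f = g.
Proof.
case: f g => [f [[fD] [fZ]]] [g [[gD] [gZ]]] /= /funext efg.
subst g; rewrite (Prop_irrelevance fZ gZ); congr GRing.Linear.Pack.
by congr GRing.Linear.Class; rewrite (Prop_irrelevance fD gD).
Qed.

Section ModuleHomZmodule.
Variables (R : pzRingType) (M N : lmodType R).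
Implicit Types f g h : mod_hom M N.

Definition mod_hom0 : mod_hom M N := (\0 : {linear M -> N}).
Definition mod_homN f : mod_hom M N :=
  (\- (f : {linear M -> N}) : {linear M -> N}).
Definition mod_homD f g : mod_hom M N :=
  ((f : {linear M -> N}) \+ (g : {linear M -> N}) : {linear M -> N}).

Fact mod_homDA : associative mod_homD.
Proof. by move=> f g h; apply: mod_homP => x /=; rewrite addrA. Qed.
Fact mod_homDC : commutative mod_homD.
Proof. by move=> f g; apply: mod_homP => x /=; rewrite addrC. Qed.
Fact mod_hom0D : left_id mod_hom0 mod_homD.
Proof. by move=> f; apply: mod_homP => x /=; rewrite add0r. Qed.
Fact mod_homND : left_inverse mod_hom0 mod_homN mod_homD.
Proof. by move=> f; apply: mod_homP => x /=; rewrite addNr. Qed.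

HB.instance Definition _ := GRing.isZmodule.Build (mod_hom M N)
  mod_homDA mod_homDC mod_hom0D mod_homND.

End ModuleHomZmodule.

(* mod_hom M N for modules over a k-algebra A, as a space over k *)
Definition alg_hom (k : fieldType) (A : algType k) (M N : lmodType A) : Type :=
  mod_hom M N.

HB.instance Definition _ (k : fieldType) (A : algType k) (M N : lmodType A) :=
  GRing.Zmodule.copy (alg_hom M N) (mod_hom M N).

Section ModuleHomLmodule.
Variables (k : fieldType) (A : algType k) (M N : lmodType A).
Implicit Types f g : alg_hom M N.

Definition alg_scale_fun (c : k) f (x : M) : N :=
  c%:A *: (f : {linear M -> N}) x.

Fact alg_scale_linear c f : linear (alg_scale_fun c f).
Proof.
move=> a x y; rewrite /alg_scale_fun linearP scalerDr !scalerA.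
by rewrite -scalerAl mul1r -scalerAr mulr1.
Qed.

HB.instance Definition _ c f := GRing.isLinear.Build A M N *:%R
  (alg_scale_fun c f) (alg_scale_linear c f).

Definition alg_scale (c : k) f : alg_hom M N :=
  (alg_scale_fun c f : {linear M -> N}).

Fact alg_scaleA a b f : alg_scale a (alg_scale b f) = alg_scale (a * b) f.
Proof.
apply: mod_homP => x /=; rewrite /alg_scale_fun /= /alg_scale_fun scalerA.
by rewrite -scalerAl mul1r scalerA.
Qed.
Fact alg_scale1 : left_id 1 alg_scale.
Proof. by move=> f; apply: mod_homP => x /=; rewrite /alg_scale_fun !scale1r. Qed.
Fact alg_scaleDr : right_distributive alg_scale +%R.
Proof. by move=> c f g; apply: mod_homP => x /=; rewrite /alg_scale_fun scalerDr. Qed.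
Fact alg_scaleDl f : {morph alg_scale^~ f : a b / a + b}.
Proof. by move=> a b; apply: mod_homP => x /=; rewrite /alg_scale_fun !scalerDl. Qed.

HB.instance Definition _ := GRing.Zmodule_isLmodule.Build k (alg_hom M N)
  alg_scaleA alg_scale1 alg_scaleDr alg_scaleDl.

End ModuleHomLmodule.

Section ModuleCategory.
Variables (k : fieldType) (A : falgType k).

Record fgMod := FgMod {
  fg_mod :> lmodType A;
  fg_modP : fin_gen fg_mod
}.

Implicit Types M N P Q : fgMod.

Definition fg_hom M N : lmodType k := alg_hom M N.

Definition fg_id M : fg_hom M M := (idfun : {linear M -> M}).

Definition fg_comp M N P (g : fg_hom N P) (f : fg_hom M N) : fg_hom M P :=
  ((g : {linear N -> P}) \o (f : {linear M -> N}) : {linear M -> P}).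

Fact fg_compA M N P Q (h : fg_hom P Q) (g : fg_hom N P) (f : fg_hom M N) :
  fg_comp h (fg_comp g f) = fg_comp (fg_comp h g) f.
Proof. exact: mod_homP. Qed.
Fact fg_comp1f M N (f : fg_hom M N) : fg_comp (fg_id N) f = f.
Proof. exact: mod_homP. Qed.
Fact fg_compf1 M N (f : fg_hom M N) : fg_comp f (fg_id M) = f.
Proof. exact: mod_homP. Qed.
Fact fg_comp_linl M N P (f : fg_hom M N) :
  linear (fun g : fg_hom N P => fg_comp g f).
Proof. by move=> c g h; exact: mod_homP. Qed.
Fact fg_comp_linr M N P (g : fg_hom N P) :
  linear (fun f : fg_hom M N => fg_comp g f).
Proof.
move=> c f h; apply: mod_homP => x /=.
by rewrite /alg_scale_fun /= linearP.
Qed.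

Definition modCat : linCat k :=
  LinCat fg_compA fg_comp1f fg_compf1 fg_comp_linl fg_comp_linr.

End ModuleCategory.

(* falgType leaves out only the zero algebra, whose module category is zero
   and hence is not a tensor category. *)
Definition is_finite_cat (k : fieldType) (C : linCat k) : Prop :=
  exists A : falgType k, equivalent C (modCat A).

(* Linear categories with a monoidal structure that is linear in both
   variables; assocV is the inverse of the associator. *)
Record monCat (k : fieldType) := MonCat {
  mon_cat :> linCat k;
  tens : mon_cat -> mon_cat -> mon_cat;
  tensm : forall X X' Y Y' : mon_cat,
    mor X X' -> mor Y Y' -> mor (tens X Y) (tens X' Y');
  tunit : mon_cat;
  assoc : forall X Y Z : mon_cat,
    mor (tens (tens X Y) Z) (tens X (tens Y Z));
  assocV : forall X Y Z : mon_cat,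
    mor (tens X (tens Y Z)) (tens (tens X Y) Z);
  lunit : forall X : mon_cat, mor (tens tunit X) X;
  runit : forall X : mon_cat, mor (tens X tunit) X;
  tensm1 : forall X Y : mon_cat, tensm (idm X) (idm Y) = idm (tens X Y);
  tensmM : forall (X X' X'' Y Y' Y'' : mon_cat)
      (f' : mor X' X'') (f : mor X X') (g' : mor Y' Y'') (g : mor Y Y'),
    tensm (f' \oc f) (g' \oc g) = tensm f' g' \oc tensm f g;
  tensm_linl : forall (X X' Y Y' : mon_cat) (g : mor Y Y'),
    linear (fun f : mor X X' => tensm f g);
  tensm_linr : forall (X X' Y Y' : mon_cat) (f : mor X X'),
    linear (fun g : mor Y Y' => tensm f g);
  assoc_inv : forall X Y Z : mon_cat, inverses (assoc X Y Z) (assocV X Y Z);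
  assoc_nat : forall (X X' Y Y' Z Z' : mon_cat)
      (f : mor X X') (g : mor Y Y') (h : mor Z Z'),
    assoc X' Y' Z' \oc tensm (tensm f g) h
      = tensm f (tensm g h) \oc assoc X Y Z;
  lunit_iso : forall X : mon_cat, is_iso (lunit X);
  lunit_nat : forall (X Y : mon_cat) (f : mor X Y),
    lunit Y \oc tensm (idm tunit) f = f \oc lunit X;
  runit_iso : forall X : mon_cat, is_iso (runit X);
  runit_nat : forall (X Y : mon_cat) (f : mor X Y),
    runit Y \oc tensm f (idm tunit) = f \oc runit X;
  pentagon : forall X Y Z W : mon_cat,
    tensm (idm X) (assoc Y Z W) \oc assoc X (tens Y Z) W
        \oc tensm (assoc X Y Z) (idm W)
      = assoc X Y (tens Z W) \oc assoc (tens X Y) Z W;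
  triangle : forall X Y : mon_cat,
    tensm (idm X) (lunit Y) \oc assoc X tunit Y = tensm (runit X) (idm Y)
}.

Arguments tens {k m} X Y.
Arguments tensm {k m X X' Y Y'} f g.
Arguments tunit {k} m.
Arguments assoc {k m} X Y Z.
Arguments assocV {k m} X Y Z.
Arguments lunit {k m} X.
Arguments runit {k m} X.

Notation "X \ox Y" := (tens X Y)
  (at level 40, left associativity, format "X  \ox  Y") : cat_scope.
Notation "f \oxm g" := (tensm f g)
  (at level 40, left associativity, format "f  \oxm  g") : cat_scope.

(* Y is a left dual of X, equivalently X is a right dual of Y. *)
Definition is_dual (k : fieldType) (C : monCat k) (Y X : C) : Prop :=
  exists (ev : mor (Y \ox X) (tunit C)) (coev : mor (tunit C) (X \ox Y)),
    runit X \oc (idm X \oxm ev) \oc assoc X Y X \oc (coev \oxm idm X)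
      = lunit X
    /\ lunit Y \oc (ev \oxm idm Y) \oc assocV Y X Y \oc (idm Y \oxm coev)
      = runit Y.

Definition is_rigid (k : fieldType) (C : monCat k) : Prop :=
  forall X : C, (exists Y : C, is_dual Y X) /\ (exists Y : C, is_dual X Y).

Record tensorCat (k : fieldType) := TensorCat {
  tensor_mon :> monCat k;
  tensor_abelian : is_abelian tensor_mon;
  tensor_rigid : is_rigid tensor_mon;
  tensor_simple_unit : is_simple (tunit tensor_mon);
  tensor_finite_length : forall X : tensor_mon, finite_length X;
  tensor_fin_hom : forall X Y : tensor_mon, fin_gen (mor X Y)
}.

Record tensorFunctor (k : fieldType) (C D : tensorCat k) := TensorFunctor {
  tensor_fun :> linFunctor C D;
  tensor_fun2 : forall X Y : C,
    mor (tensor_fun X \ox tensor_fun Y) (tensor_fun (X \ox Y));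
  tensor_fun0 : mor (tunit D) (tensor_fun (tunit C));
  tensor_fun2_iso : forall X Y : C, is_iso (tensor_fun2 X Y);
  tensor_fun0_iso : is_iso tensor_fun0;
  tensor_fun2_nat : forall (X X' Y Y' : C) (f : mor X X') (g : mor Y Y'),
    tensor_fun2 X' Y' \oc (fmap tensor_fun f \oxm fmap tensor_fun g)
      = fmap tensor_fun (f \oxm g) \oc tensor_fun2 X Y;
  tensor_fun_assoc : forall X Y Z : C,
    fmap tensor_fun (assoc X Y Z) \oc tensor_fun2 (X \ox Y) Z
        \oc (tensor_fun2 X Y \oxm idm (tensor_fun Z))
      = tensor_fun2 X (Y \ox Z) \oc (idm (tensor_fun X) \oxm tensor_fun2 Y Z)
        \oc assoc (tensor_fun X) (tensor_fun Y) (tensor_fun Z);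
  tensor_fun_lunit : forall X : C,
    fmap tensor_fun (lunit X) \oc tensor_fun2 (tunit C) X
        \oc (tensor_fun0 \oxm idm (tensor_fun X))
      = lunit (tensor_fun X);
  tensor_fun_runit : forall X : C,
    fmap tensor_fun (runit X) \oc tensor_fun2 X (tunit C)
        \oc (idm (tensor_fun X) \oxm tensor_fun0)
      = runit (tensor_fun X)
}.

Arguments tensor_fun2 {k C D} F X Y : rename.
Arguments tensor_fun0 {k C D} F : rename.

Record Nat_tensor (k : fieldType) (C D : tensorCat k)
    (F G : tensorFunctor C D) := NatTensor {
  nat_map :> forall X : C, mor (F X) (G X);
  nat_natural : forall (X Y : C) (f : mor X Y),
    nat_map Y \oc fmap F f = fmap G f \oc nat_map X;
  nat_tens : forall X Y : C,
    nat_map (X \ox Y) \oc tensor_fun2 F X Y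
      = tensor_fun2 G X Y \oc (nat_map X \oxm nat_map Y);
  nat_unit : nat_map (tunit C) \oc tensor_fun0 F = tensor_fun0 G
}.

(* The same notion as finite_set, for a type: the universe of finite_set is too
   small for families indexed by the objects of a large category. *)
Definition is_finite_type (T : Type) : Prop :=
  exists (n : nat) (e : 'I_n -> T), bijective e.

(* Main.v *)
Require Import Defs.
From mathcomp Require Import all_boot all_algebra falgebra.
From HB Require Import structures.
From mathcomp Require Import boolp.

(** The argument is Dedekind's independence of characters, transported to tensor
    categories: pairwise distinct monoidal natural transformations F -> G are
    linearly independent in a finite-dimensional space of morphisms, so there
    are at most as many of them as its dimension.

    The space is Hom(F P, G P), where P generates C: every object of C is a
    quotient of a finite power of P ([finite_cat_generator]), and F preserves
    these quotients because it is right exact, so a natural transformation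
    that vanishes at P vanishes everywhere ([nat_eq0_generator]).

    Dedekind's argument compares two expansions.  If eta_0 = sum d_i eta_i with
    the eta_i independent at P, then evaluating at P (x) P, where a monoidal
    transformation eta becomes eta_P (x) eta_P, gives
      sum d_i eta_i(P) (x) eta_i(P) = eta_0(P) (x) eta_0(P)
        = sum d_i eta_i(P) (x) eta_0(P),
    that is, sum eta_i(P) (x) d_i (eta_i(P) - eta_0(P)) = 0.  To conclude that
    d_i (eta_i(P) - eta_0(P)) = 0 for each i, one needs
      Hom(X, X') (x) Hom(Y, Y') -> Hom(X (x) Y, X' (x) Y')
    to be injective ([tensm_indep]).  Rigidity reduces this to the injectivity
    of the composition map Hom(A, 1) (x) Hom(1, B) -> Hom(A, B): a morphism
    X -> X' is as good as a morphism X'^* (x) X -> 1, and Y -> Y' as good as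
    1 -> Y' (x) Y^*.  The composition map is injective because 1 is simple with
    End(1) = k ([simple_comp_indep], [schur_scalar]); algebraic closedness of k
    enters there.  So all d_i vanish and eta_0 = 0, which is absurd at the unit
    object ([Nat_tensor_unit_neq0]). *)

Set Implicit Arguments.
Unset Strict Implicit.
Unset Printing Implicit Defensive.

Import GRing.Theory.
Local Open Scope ring_scope.
Local Open Scope cat_scope.

(** * Linear maps, independent families and finite types *)

Lemma linear_struct (k : fieldType) (U V : lmodType k) (f : U -> V) :
  linear f -> exists g : {linear U -> V}, f = g.
Proof.
move=> f_lin.
pose g : {linear U -> V} :=
  HB.pack f (GRing.isLinear.Build k U V *:%R f f_lin).
by exists g.
Qed.

(** The categories under study carry linearity as a bare property of functions;
    these lemmas bring the rules for structured linear maps to that form. *)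
Lemma linear_fun0 (k : fieldType) (U V : lmodType k) (f : U -> V) :
  linear f -> f 0 = 0.
Proof. by case/linear_struct => g ->; exact: linear0. Qed.

Lemma linear_funD (k : fieldType) (U V : lmodType k) (f : U -> V) x y :
  linear f -> f (x + y) = f x + f y.
Proof. by case/linear_struct => g ->; exact: linearD. Qed.

Lemma linear_funB (k : fieldType) (U V : lmodType k) (f : U -> V) x y :
  linear f -> f (x - y) = f x - f y.
Proof. by case/linear_struct => g ->; exact: linearB. Qed.

Lemma linear_funZ (k : fieldType) (U V : lmodType k) (f : U -> V) c x :
  linear f -> f (c *: x) = c *: f x.
Proof. by case/linear_struct => g ->; exact: linearZ_LR. Qed.

Lemma linear_fun_sum (k : fieldType) (U V : lmodType k) (f : U -> V) (n : nat)
    (x : 'I_n -> U) :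
  linear f -> f (\sum_i x i) = \sum_i f (x i).
Proof. by case/linear_struct => g ->; exact: linear_sum. Qed.

Lemma linear_comb (k : fieldType) (U V : lmodType k) (f : U -> V) (n : nat)
    (c : 'I_n -> k) (x : 'I_n -> U) :
  linear f -> f (\sum_i c i *: x i) = \sum_i c i *: f (x i).
Proof.
move=> f_lin; rewrite (linear_fun_sum _ f_lin).
by apply: eq_bigr => i _; rewrite (linear_funZ _ _ f_lin).
Qed.

Lemma linear_funcomp (k : fieldType) (U V W : lmodType k) (f : U -> V)
    (g : V -> W) : linear f -> linear g -> linear (fun x => g (f x)).
Proof. by move=> f_lin g_lin c x y; rewrite f_lin g_lin. Qed.

Definition lin_indep (k : fieldType) (V : lmodType k) (n : nat)
    (x : 'I_n -> V) : Prop :=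
  forall c : 'I_n -> k, \sum_i c i *: x i = 0 -> forall i, c i = 0.

(** Over a family of N generators, the coefficient rows of more than N vectors
    have a nonzero left kernel, which is a relation between the vectors. *)
Lemma lin_indep_bound (k : fieldType) (V : lmodType k) :
  fin_gen V -> exists N, forall n (x : 'I_n -> V), lin_indep x -> (n <= N)%N.
Proof.
case=> N [v v_gen]; exists N => n x x_indep; rewrite leqNgt; apply/negP => ltNn.
have [M defM] := choice (fun i => v_gen (x i)).
pose A := \matrix_(i < n, j < N) M i j.
have : kermx A != 0.
  rewrite kermx_eq0 /row_free neq_ltn.
  by rewrite (leq_ltn_trans (rank_leq_col A) ltNn).
case/eqP; apply/matrixP => l i; rewrite [RHS]mxE.
apply: (x_indep (fun i => kermx A l i)) i.
under eq_bigr do rewrite defM scaler_sumr.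
rewrite exchange_big big1 //= => j _.
under eq_bigr do rewrite scalerA.
rewrite -scaler_suml.
have /matrixP/(_ l j) := mulmx_ker A; rewrite mxE [RHS]mxE.
by under eq_bigr do rewrite [A _ _]mxE; move=> ->; rewrite scale0r.
Qed.

(** An injection from the largest possible [n] is onto: a missed point would
    extend it to an injection from [n.+1]. *)
Lemma bounded_injections_finite (T : Type) (N : nat) :
  (forall n (e : 'I_n -> T), injective e -> (n <= N)%N) -> is_finite_type T.
Proof.
move=> T_bound.
pose has_inj n := `[< exists e : 'I_n -> T, injective e >].
have ex_inj : exists n, has_inj n.
  exists 0; apply/asboolP.
  by exists (fun i : 'I_0 => False_rect T (notF (ltn_ord i))); case.
have inj_bound n : has_inj n -> (n <= N)%N by case/asboolP => e; apply: T_bound.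
case: (ex_maxnP ex_inj inj_bound) => n /asboolP[e e_inj] n_max; exists n, e.
have e_surj t : exists i, e i = t.
  apply: contrapT => t_new.
  suff /n_max : has_inj n.+1 by rewrite ltnn.
  apply/asboolP.
  exists (fun i => if unlift ord0 i is Some j then e j else t) => i j.
  case: unliftP => [i'|] ->; case: unliftP => [j'|] -> //.
  - by move/e_inj ->.
  - by move=> ei; case: t_new; exists i'.
  - by move=> ei; case: t_new; exists j'.
have [g eg] := choice e_surj.
by exists g => // i; apply: e_inj; rewrite eg.
Qed.

(** * Simple objects in linear abelian categories *)

Lemma kernel_mono (k : fieldType) (C : linCat k) (K X Y : C) (f : mor X Y)
    (i : mor K X) : is_kernel f i -> is_mono i.
Proof.
case=> fi0 i_univ W g h eq_ig.
have [|l [_ l_uniq]] := i_univ W (i \oc g).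
  by rewrite compmA fi0 (linear_fun0 (compm_linl g)).
by rewrite -(l_uniq g) // -(l_uniq h).
Qed.

Lemma iso_epi (k : fieldType) (C : linCat k) (X Y : C) (f : mor X Y) :
  is_iso f -> is_epi f.
Proof.
case=> f' [_ ff'] W g h /(congr1 (fun t => t \oc f')).
by rewrite -!compmA ff' !compm1.
Qed.

Lemma iso_mono (k : fieldType) (C : linCat k) (X Y : C) (f : mor X Y) :
  is_iso f -> is_mono f.
Proof.
case=> f' [f'f _] W g h /(congr1 (fun t => f' \oc t)).
by rewrite !compmA f'f !comp1m.
Qed.

Lemma epi_eq0 (k : fieldType) (C : linCat k) (X Y Z : C) (f : mor X Y)
    (g : mor Y Z) : is_epi f -> g \oc f = 0 -> g = 0.
Proof.
by move=> f_epi gf0; apply: f_epi; rewrite gf0 (linear_fun0 (compm_linl f)).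
Qed.

Lemma mono_eq0 (k : fieldType) (C : linCat k) (X Y Z : C) (f : mor X Y)
    (g : mor Y Z) : is_mono g -> g \oc f = 0 -> f = 0.
Proof.
by move=> g_mono gf0; apply: g_mono; rewrite gf0 (linear_fun0 (compm_linr g)).
Qed.

Lemma cokernel_epi (k : fieldType) (C : linCat k) (X Y Q : C) (f : mor X Y)
    (p : mor Y Q) : is_cokernel f p -> is_epi p.
Proof.
case=> pf0 p_univ W g h eq_gp.
have [|l [_ l_uniq]] := p_univ W (g \oc p).
  by rewrite -compmA pf0 (linear_fun0 (compm_linr g)).
by rewrite -(l_uniq g) // -(l_uniq h).
Qed.

Lemma simple_id_neq0 (k : fieldType) (C : linCat k) (S : C) :
  is_simple S -> idm S <> 0.
Proof.
case=> S_nz _ id0; apply: S_nz => X; split=> f.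
  by rewrite -[f]comp1m id0 (linear_fun0 (compm_linl f)).
by rewrite -[f]compm1 id0 (linear_fun0 (compm_linr f)).
Qed.

Lemma nonzero_from_simple_mono (k : fieldType) (C : linCat k) (S B : C)
    (f : mor S B) : is_abelian C -> is_simple S -> f <> 0 -> is_mono f.
Proof.
move=> C_ab [_ S_simple] f_nz W g h eq_fg.
have [K [i ker_i]] := abelian_kernel C_ab f.
have [fi0 i_univ] := ker_i.
case: (S_simple K i (kernel_mono ker_i)) => [K0|i_iso]; last first.
  by case: f_nz; apply: epi_eq0 (iso_epi i_iso) fi0.
have [|l [il _]] := i_univ W (g - h).
  by rewrite (linear_funB _ _ (compm_linr f)) eq_fg subrr.
apply/eqP; rewrite -subr_eq0 -il (proj1 (K0 W) l).
by rewrite (linear_fun0 (compm_linr i)).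
Qed.

Lemma nonzero_to_simple_epi (k : fieldType) (C : linCat k) (A S : C)
    (f : mor A S) : is_abelian C -> is_simple S -> f <> 0 -> is_epi f.
Proof.
move=> C_ab [_ S_simple] f_nz W g h eq_gf.
have [Q [p [pf0 p_univ]]] := abelian_cokernel C_ab f.
have [I [m ker_m]] := abelian_kernel C_ab p.
have [pm0 m_univ] := ker_m.
case: (S_simple I m (kernel_mono ker_m)) => [I0|m_iso].
  have [e [me _]] := m_univ A f pf0.
  by case: f_nz; rewrite -me (proj1 (I0 A) e) (linear_fun0 (compm_linr m)).
have p0 : p = 0 := epi_eq0 (iso_epi m_iso) pm0.
have [|l [lp _]] := p_univ W (g - h).
  by rewrite (linear_funB _ _ (compm_linl f)) eq_gf subrr.
by apply/eqP; rewrite -subr_eq0 -lp p0 (linear_fun0 (compm_linr l)).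
Qed.

(** In an abelian category an epimorphism is the cokernel of some morphism, and
    that morphism factors through the kernel; so maps killing the kernel
    descend. *)
Lemma epi_cokernel_of_kernel (k : fieldType) (C : linCat k) (K A Q T : C)
    (f : mor A Q) (i : mor K A) (t : mor A T) :
  is_abelian C -> is_epi f -> is_kernel f i -> t \oc i = 0 ->
  exists s : mor Q T, t = s \oc f.
Proof.
move=> C_ab f_epi [_ i_univ] ti0.
have [Z [h [fh0 f_univ]]] := abelian_epi C_ab f_epi.
have [l [il _]] := i_univ Z h fh0.
have [|s [sf _]] := f_univ T t; last by exists s.
by rewrite -il compmA ti0 (linear_fun0 (compm_linl l)).
Qed.

(** Schur's lemma in scalar form.  Left composition by [f] is lifted to a
    matrix M acting on the coefficients of a generating family.  The
    Cayley-Hamilton theorem for M then gives a product of factors f - z killing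
    the identity; as a nonzero endomorphism of S is monic, one of these factors
    is zero. *)
Lemma schur_scalar (k : closedFieldType) (C : linCat k) (S : C)
    (f : mor S S) :
  is_abelian C -> is_simple S -> fin_gen (mor S S) ->
  exists c : k, f = c *: idm S.
Proof.
move=> C_ab S_simple [n [v v_gen]].
case: n => [|n] in v v_gen *.
  have [c] := v_gen (idm S); rewrite big_ord0 => id0.
  by case: (simple_id_neq0 S_simple).
have [m defm] := choice (fun i => v_gen (f \oc v i)).
pose M := \matrix_(i < n.+1, j < n.+1) m i j.
pose psi (w : 'rV[k]_n.+1) : mor S S := \sum_i w 0 i *: v i.
have psiM w z : psi (w *m (M - z%:M)) = (f - z *: idm S) \oc psi w.
  have -> : (f - z *: idm S) \oc psi w = f \oc psi w - z *: psi w.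
    rewrite (linear_funB _ _ (compm_linl (psi w))).
    by rewrite (linear_funZ _ _ (compm_linl (psi w))) comp1m.
  rewrite (linear_comb _ _ (compm_linr f)) mulmxBr mul_mx_scalar /psi.
  rewrite scaler_sumr -sumrB.
  under eq_bigr do rewrite !mxE scalerBl -scalerA.
  rewrite !sumrB; congr (_ - _).
  under [RHS]eq_bigr do rewrite defm scaler_sumr.
  rewrite exchange_big; apply: eq_bigr => j _ /=.
  rewrite scaler_suml; apply: eq_bigr => i _.
  by rewrite !mxE scalerA.
have eig r w : psi (w *m horner_mx M (\prod_(z <- r) ('X - z%:P))) = 0 ->
    psi w = 0 \/ exists z, f = z *: idm S.
  elim: r w => [|z r IHr] w; first by rewrite big_nil rmorph1 mulmx1; left.
  rewrite big_cons rmorphM rmorphB /= horner_mx_X horner_mx_C -mulmxE mulmxA.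
  case/IHr => [|?]; last by right.
  rewrite psiM; case: (EM (f - z *: idm S = 0)) => [/eqP|fz_nz].
    by rewrite subr_eq0 => /eqP ->; right; exists z.
  by left; apply: mono_eq0 (nonzero_from_simple_mono C_ab S_simple fz_nz) _.
have [c def_id] := v_gen (idm S).
have psi_id : psi (\row_i c i) = idm S.
  by rewrite def_id; apply: eq_bigr => i _; rewrite mxE.
have [r char_r] := closed_field_poly_normal (char_poly M).
have := Cayley_Hamilton M; rewrite char_r (monicP (char_poly_monic M)) scale1r.
move=> CH; case: (eig r (\row_i c i)) => //.
  by rewrite CH mulmx0 /psi big1 // => i _; rewrite mxE scale0r.
by rewrite psi_id => id0; case: (simple_id_neq0 S_simple).
Qed.

(** The map Hom(A, S) (x) Hom(S, B) -> Hom(A, B) is injective when S is simple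
    with scalar endomorphisms.  The induction restricts to the kernel of the
    first [f]: the other ones stay independent there, since a combination of
    them that vanishes on this kernel factors through S and hence is a multiple
    of the first. *)
Lemma simple_comp_indep (k : closedFieldType) (C : linCat k) (S : C) (n : nat)
    (A B : C) (f : 'I_n -> mor A S) (g : 'I_n -> mor S B) :
  is_abelian C -> is_simple S -> fin_gen (mor S S) ->
  lin_indep f -> \sum_i (g i \oc f i) = 0 -> forall i, g i = 0.
Proof.
move=> C_ab S_simple S_fin; elim: n A f g => [|n IHn] A f g f_indep.
  by move=> _ [].
rewrite big_ord_recl => fg0.
have indep0 (c0 : k) (c : 'I_n -> k) :
    c0 *: f ord0 + \sum_i c i *: f (lift ord0 i) = 0 ->
    c0 = 0 /\ forall i, c i = 0.
  pose d i := if unlift ord0 i is Some j then c j else c0.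
  move=> rel; have := f_indep d; rewrite big_ord_recl /d unlift_none.
  under eq_bigr do rewrite liftK.
  move=> /(_ rel) d0; split; first by have := d0 ord0; rewrite unlift_none.
  by move=> i; have := d0 (lift ord0 i); rewrite liftK.
have f0_nz : f ord0 <> 0.
  move=> f00; have [|/eqP] := indep0 1 (fun=> 0); last by rewrite oner_eq0.
  by rewrite f00 scaler0 add0r big1 // => i _; rewrite scale0r.
have f0_epi := nonzero_to_simple_epi C_ab S_simple f0_nz.
have [K [u ker_u]] := abelian_kernel C_ab (f ord0).
have g_lift0 : forall i, g (lift ord0 i) = 0.
  apply: (IHn K (fun i => f (lift ord0 i) \oc u)) => [c rel|].
    have [|s] := epi_cokernel_of_kernel
                   (t := \sum_i c i *: f (lift ord0 i)) C_ab f0_epi ker_u.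
      by rewrite (linear_comb _ _ (compm_linl u)).
    (* The factor is a scalar b, so the combination is b times the first f. *)
    have [b ->] := schur_scalar s C_ab S_simple S_fin.
    rewrite (linear_funZ _ _ (compm_linl (f ord0))) comp1m => rel_f.
    have [|//] := indep0 (- b) c.
    by rewrite rel_f scaleNr addNr.
  have := congr1 (fun t => t \oc u) fg0.
  rewrite (linear_fun0 (compm_linl u)) (linear_funD _ _ (compm_linl u)).
  rewrite -compmA (proj1 ker_u) (linear_fun0 (compm_linr (g ord0))) add0r.
  rewrite (linear_fun_sum _ (compm_linl u)) => sum0; rewrite -[RHS]sum0.
  by apply: eq_bigr => i _; rewrite compmA.
move=> i; case: (unliftP ord0 i) => [j|] ->; first exact: g_lift0.
move: fg0; rewrite big1 ?addr0 => [|j _]; first exact: epi_eq0.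
by rewrite g_lift0 (linear_fun0 (compm_linl _)).
Qed.

(** * Tensor products of independent morphisms *)

(** Recovers [f : X -> X'] from its mate [Z (x) X -> 1], where Z is a left dual
    of X'; in particular [f] is zero when its mate is. *)
Lemma ev_mateK (k : fieldType) (C : monCat k) (X X' Z : C)
    (ev : mor (Z \ox X') (tunit C)) (coev : mor (tunit C) (X' \ox Z))
    (f : mor X X') :
  runit X' \oc (idm X' \oxm ev) \oc assoc X' Z X' \oc (coev \oxm idm X')
    = lunit X' ->
  f \oc lunit X
    = runit X' \oc (idm X' \oxm (ev \oc (idm Z \oxm f))) \oc assoc X' Z X
        \oc (coev \oxm idm X).
Proof.
move=> zigzag; rewrite -lunit_nat -zigzag -[LHS]compmA -tensmM comp1m compm1.
have -> : idm X' \oxm (ev \oc (idm Z \oxm f))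
    = (idm X' \oxm ev) \oc (idm X' \oxm (idm Z \oxm f)).
  by rewrite -tensmM comp1m.
rewrite -!compmA; congr (_ \oc (_ \oc _)).
by rewrite [RHS]compmA -assoc_nat tensm1 -compmA -tensmM comp1m compm1.
Qed.

(** Recovers [g : Y -> Y'] from its mate [1 -> Y' (x) V], where V is a left dual
    of Y. *)
Lemma coev_mateK (k : fieldType) (C : monCat k) (Y Y' V : C)
    (ev : mor (V \ox Y) (tunit C)) (coev : mor (tunit C) (Y \ox V))
    (g : mor Y Y') :
  runit Y \oc (idm Y \oxm ev) \oc assoc Y V Y \oc (coev \oxm idm Y)
    = lunit Y ->
  g \oc lunit Y
    = runit Y' \oc (idm Y' \oxm ev) \oc assoc Y' V Y
        \oc (((g \oxm idm V) \oc coev) \oxm idm Y).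
Proof.
move=> <-; rewrite !compmA -runit_nat -!compmA; congr (_ \oc _).
have -> : ((g \oxm idm V) \oc coev) \oxm idm Y
    = ((g \oxm idm V) \oxm idm Y) \oc (coev \oxm idm Y).
  by rewrite -tensmM comp1m.
rewrite !compmA; congr (_ \oc _).
rewrite -[RHS]compmA assoc_nat tensm1 compmA; congr (_ \oc _).
by rewrite -!tensmM !comp1m !compm1.
Qed.

(** Shows that the left side, the bulk of the tensor product of two mates,
    depends linearly on [f (x) g] alone. *)
Lemma tensm_mates (k : fieldType) (C : monCat k) (X X' Y Y' Z V : C)
    (f : mor X X') (g : mor Y Y') :
  (idm Z \oxm f) \oxm (g \oxm idm V)
    = assocV Z X' (Y' \ox V)
        \oc (idm Z \oxm (assoc X' Y' V \oc ((f \oxm g) \oxm idm V)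
                           \oc assocV X Y V))
        \oc assoc Z X (Y \ox V).
Proof.
have -> : assoc X' Y' V \oc ((f \oxm g) \oxm idm V) \oc assocV X Y V
    = f \oxm (g \oxm idm V).
  by rewrite assoc_nat -compmA (proj2 (assoc_inv X Y V)) compm1.
by rewrite -compmA -assoc_nat compmA (proj1 (assoc_inv _ _ _)) comp1m.
Qed.

(** Turns a tensor product of morphisms into and out of the unit into their
    composite, up to the automorphism of the unit that compares its left and
    right unit constraints; an automorphism is harmless when the aim is to show
    that a factor vanishes. *)
Lemma tensm_unit_mates (k : fieldType) (C : monCat k) (A B : C)
    (f : mor A (tunit C)) (g : mor (tunit C) B) rV rAV :
  inverses (runit (tunit C)) rV -> inverses (runit A) rAV ->
  g \oc (lunit (tunit C) \oc rV) \oc f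
    = lunit B \oc (f \oxm g) \oc rAV.
Proof.
move=> [rVK _] [_ rAVK].
have -> : f \oxm g = (idm (tunit C) \oxm g) \oc (f \oxm idm (tunit C)).
  by rewrite -tensmM comp1m compm1.
rewrite !compmA lunit_nat -!compmA; congr (_ \oc (_ \oc _)).
rewrite -[LHS]compm1 -rAVK -[LHS]compmA [X in rV \oc X]compmA -runit_nat.
by rewrite -[X in rV \oc X]compmA compmA rVK comp1m.
Qed.

(** The map Hom(X, X') (x) Hom(Y, Y') -> Hom(X (x) Y, X' (x) Y') is injective:
    the mates of the [f i] stay independent, those of the [g i] vanish by
    [simple_comp_indep], and then so do the [g i]. *)
Lemma tensm_indep (k : closedFieldType) (D : tensorCat k) (n : nat)
    (X X' Y Y' : D) (f : 'I_n -> mor X X') (g : 'I_n -> mor Y Y') :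
  lin_indep f -> \sum_i (f i \oxm g i) = 0 -> forall i, g i = 0.
Proof.
move=> f_indep fg0 i.
have [[Z [ev [coev [zig _]]]] _] := tensor_rigid X'.
have [[V [ev' [coev' [zig' _]]]] _] := tensor_rigid Y.
pose fh j : mor (Z \ox X) (tunit D) := ev \oc (idm Z \oxm f j).
pose gh j : mor (tunit D) (Y' \ox V) := (g j \oxm idm V) \oc coev'.
have [rV rVK] := runit_iso (tunit D).
have [rAV rAVK] := runit_iso (Z \ox X).
have [lXV [_ lXVK]] := lunit_iso X.
have [lYV [_ lYVK]] := lunit_iso Y.
have [lV [_ lVK]] := lunit_iso (tunit D).
pose theta : mor (tunit D) (tunit D) := lunit (tunit D) \oc rV.
have fh_indep : lin_indep fh.
  move=> c; rewrite /fh.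
  have fh_lin : linear (fun t : mor X X' => ev \oc (idm Z \oxm t)).
    exact: linear_funcomp (tensm_linr _) (compm_linr _).
  rewrite -(linear_comb _ _ fh_lin) => mate0; apply: f_indep.
  rewrite -[LHS]compm1 -lXVK compmA (ev_mateK _ zig) mate0.
  rewrite (linear_fun0 (tensm_linr _)) (linear_fun0 (compm_linr _)).
  by rewrite !(linear_fun0 (compm_linl _)).
have sum0 : \sum_j (gh j \oc theta \oc fh j) = 0.
  (* L sends f (x) g to the composite of the two mates. *)
  pose L (t : mor (X \ox Y) (X' \ox Y')) :=
    lunit (Y' \ox V) \oc ((ev \oxm idm (Y' \ox V))
      \oc (assocV Z X' (Y' \ox V)
        \oc (idm Z \oxm (assoc X' Y' V \oc (t \oxm idm V) \oc assocV X Y V))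
        \oc assoc Z X (Y \ox V))
      \oc (idm (Z \ox X) \oxm coev')) \oc rAV.
  have L_lin : linear L.
    rewrite /L.
    apply: (linear_funcomp _ (compm_linl _)).
    apply: (linear_funcomp _ (compm_linr _)).
    apply: (linear_funcomp _ (compm_linl _)).
    apply: (linear_funcomp _ (compm_linr _)).
    apply: (linear_funcomp _ (compm_linl _)).
    apply: (linear_funcomp _ (compm_linr _)).
    apply: (linear_funcomp _ (tensm_linr _)).
    apply: (linear_funcomp _ (compm_linl _)).
    apply: (linear_funcomp _ (compm_linr _)).
    exact: tensm_linl.
  rewrite -[RHS](linear_fun0 L_lin) -fg0 (linear_fun_sum _ L_lin).
  apply: eq_bigr => j _; rewrite (tensm_unit_mates _ _ rVK rAVK) /L.
  by rewrite -tensm_mates -!tensmM !comp1m !compm1.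
have gh_theta0 := simple_comp_indep (tensor_abelian D) (tensor_simple_unit D)
  (tensor_fin_hom _ _) fh_indep sum0 i.
have gh0 : gh i = 0.
  rewrite -[LHS]compm1 -lVK -[X in X \oc lV]compm1 -(proj1 rVK).
  rewrite !compmA -[X in X \oc _ \oc _]compmA gh_theta0.
  by rewrite !(linear_fun0 (compm_linl _)).
rewrite -[LHS]compm1 -lYVK compmA (coev_mateK _ zig') -/(gh i) gh0.
rewrite (linear_fun0 (tensm_linl _)) (linear_fun0 (compm_linr _)).
exact: linear_fun0 (compm_linl _).
Qed.

(** * A generator of a finite category *)

(** F is faithful and reflects epimorphisms, and [F (G q)] is isomorphic to
    [q]. *)
Lemma equivalence_epi (k : fieldType) (C M : linCat k) (F : linFunctor C M)
    (G : linFunctor M C) (u : forall X : C, mor X (G (F X)))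
    (e : forall Y : M, mor (F (G Y)) Y) (Y Y' : M) (q : mor Y Y') :
  (forall X, is_iso (u X)) ->
  (forall X X' (f : mor X X'), u X' \oc f = fmap G (fmap F f) \oc u X) ->
  (forall Z, is_iso (e Z)) ->
  (forall Z Z' (g : mor Z Z'), g \oc e Z = e Z' \oc fmap F (fmap G g)) ->
  is_epi q -> is_epi (fmap G q).
Proof.
move=> u_iso u_nat e_iso e_nat q_epi W g h eq_gh.
apply: (iso_mono (u_iso W)); rewrite !u_nat; congr (fmap G _ \oc _).
have [eV [eVK _]] := e_iso Y'.
suff eV_eq : fmap F g \oc eV = fmap F h \oc eV.
  by rewrite -[LHS]compm1 -[RHS]compm1 -eVK !compmA eV_eq.
apply: q_epi; apply: (iso_epi (e_iso Y)).
rewrite -!compmA e_nat [eV \oc _]compmA eVK comp1m.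
by rewrite -!fmapM eq_gh.
Qed.

(** Here S stands for a finite power of P with its inclusions and projections;
    the equation between them is the only part of this structure that a linear
    functor has to transport. *)
Definition fin_generator (k : fieldType) (C : linCat k) (P : C) : Prop :=
  forall X : C, exists (S : C) (n : nat) (i : 'I_n -> mor P S)
      (q : 'I_n -> mor S P) (p : mor S X),
    \sum_j (i j \oc q j) = idm S /\ is_epi p.

Lemma row_fin_gen (k : fieldType) (A : falgType k) (n : nat) :
  fin_gen ('rV[A]_n : lmodType A).
Proof.
exists n, (fun i => delta_mx 0 i) => x.
by exists (fun i => x 0 i); rewrite [LHS]row_sum_delta.
Qed.

Definition row_mod (k : fieldType) (A : falgType k) (n : nat) : modCat A :=
  FgMod (row_fin_gen A n).

(** Row vectors form a left module, so right multiplication by a matrix is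
    linear even over a noncommutative algebra. *)
Definition row_hom (k : fieldType) (A : falgType k) (m n : nat)
    (B : 'M[A]_(m, n)) : mor (row_mod A m) (row_mod A n) :=
  (mulmxr B : {linear 'rV[A]_m -> 'rV[A]_n}).

Lemma fg_hom_sumE (k : fieldType) (A : falgType k) (M N : fgMod A) (n : nat)
    (h : 'I_n -> fg_hom M N) (x : M) :
  ((\sum_i h i : fg_hom M N) : {linear M -> N}) x
    = \sum_i (h i : {linear M -> N}) x.
Proof. exact: (big_morph (fun f : fg_hom M N => (f : {linear M -> N}) x)). Qed.

Lemma row_mod_generator (k : fieldType) (A : falgType k) :
  fin_generator (row_mod A 1).
Proof.
move=> X; have [n [v v_gen]] := fg_modP X.
pose p0 (w : 'rV[A]_n) : X := \sum_i w 0 i *: v i.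
have p0_lin : linear p0.
  move=> a w w'; rewrite /p0 scaler_sumr -big_split; apply: eq_bigr => i _ /=.
  by rewrite !mxE scalerDl scalerA.
have [p def_p] : exists p : {linear 'rV[A]_n -> X}, p =1 p0.
  pose p : {linear 'rV[A]_n -> X} :=
    HB.pack p0 (GRing.isLinear.Build A 'rV[A]_n X *:%R p0 p0_lin).
  by exists p.
exists (row_mod A n), n, (fun j => row_hom (delta_mx 0 j)),
  (fun j => row_hom (delta_mx j 0)), (p : fg_hom (row_mod A n) X); split.
  apply: mod_homP => x; rewrite [LHS]fg_hom_sumE /=.
  under eq_bigr do rewrite -mulmxA mul_delta_mx.
  by rewrite -mulmx_sumr -mx1_sum_delta mulmx1.
move=> W g h eq_gh; apply: mod_homP => x.
have [c ->] := v_gen x.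
have -> : \sum_i c i *: v i = p (\row_i c i).
  by rewrite def_p; apply: eq_bigr => i _; rewrite mxE.
exact: (congr1 (fun t : fg_hom (row_mod A n) W =>
  (t : {linear 'rV[A]_n -> W}) (\row_i c i)) eq_gh).
Qed.

Lemma finite_cat_generator (k : fieldType) (C : linCat k) :
  is_finite_cat C -> exists P : C, fin_generator P.
Proof.
case=> A [F [G [u [e [u_iso u_nat e_iso e_nat]]]]].
exists (G (row_mod A 1)) => X.
have [S [n [i [q [p [iq_id p_epi]]]]]] := row_mod_generator (F X).
have [uV [uVK uKV]] := u_iso X.
exists (G S), n, (fun j => fmap G (i j)), (fun j => fmap G (q j)),
  (uV \oc fmap G p); split.
  under eq_bigr do rewrite -fmapM.
  by rewrite -(linear_fun_sum _ (@fmap_lin _ _ _ G _ _)) iq_id fmap1.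
move=> W g h; rewrite !compmA.
move/(equivalence_epi u_iso u_nat e_iso e_nat p_epi).
by apply: iso_epi; exists (u X).
Qed.

(** Right exactness is what makes the image under F of an epimorphism onto X
    again an epimorphism, so that a natural transformation is determined at X
    by its value on the source, hence on P. *)
Lemma nat_eq0_generator (k : fieldType) (C D : linCat k) (F G : linFunctor C D)
    (P : C) (a : forall X : C, mor (F X) (G X)) :
  is_abelian C -> right_exact F -> fin_generator P ->
  (forall (X Y : C) (f : mor X Y), a Y \oc fmap F f = fmap G f \oc a X) ->
  a P = 0 -> forall X, a X = 0.
Proof.
move=> C_ab F_rex P_gen a_nat aP0 X.
have [S [n [i [q [p [iq_id p_epi]]]]]] := P_gen X.
have [Z [f coker_p]] := abelian_epi C_ab p_epi.
apply: epi_eq0 (cokernel_epi (F_rex _ _ _ _ _ coker_p)) _.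
rewrite a_nat; suff -> : a S = 0 by apply: linear_fun0 (compm_linr _).
rewrite -[a S]compm1 -fmap1 -iq_id (linear_fun_sum _ (@fmap_lin _ _ _ F _ _)).
rewrite (linear_fun_sum _ (compm_linr (a S))) big1 // => j _.
rewrite fmapM compmA a_nat aP0 (linear_fun0 (compm_linr _)).
exact: linear_fun0 (compm_linl _).
Qed.

(** * Independence of monoidal natural transformations *)

Lemma Nat_tensor_ext (k : fieldType) (C D : tensorCat k)
    (F G : tensorFunctor C D) (a b : Nat_tensor F G) :
  (forall X, a X = b X) -> a = b.
Proof.
case: a b => [a a1 a2 a3] [b b1 b2 b3] /= eq_ab.
have {eq_ab} eq_ab : a = b by apply: functional_extensionality_dep.
by subst b; congr NatTensor; apply: Prop_irrelevance.
Qed.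

(** A linear relation at the generator holds everywhere, since the difference of
    the two sides is natural, although it is not monoidal. *)
Lemma Nat_tensor_comb_generator (k : fieldType) (C D : tensorCat k)
    (F G : tensorFunctor C D) (P : C) (n : nat) (eta0 : Nat_tensor F G)
    (d : 'I_n -> k) (eta : 'I_n -> Nat_tensor F G) :
  right_exact F -> fin_generator P ->
  eta0 P = \sum_i d i *: eta i P ->
  forall X, eta0 X = \sum_i d i *: eta i X.
Proof.
move=> F_rex P_gen relP X; apply/eqP; rewrite -subr_eq0; apply/eqP.
pose a Y : mor (F Y) (G Y) := eta0 Y - \sum_i d i *: eta i Y.
apply: (nat_eq0_generator (a := a) (tensor_abelian C) F_rex P_gen); last first.
  by rewrite /a relP subrr.
move=> Y Z f; rewrite /a (linear_funB _ _ (compm_linl _)).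
rewrite (linear_funB _ _ (compm_linr _)) nat_natural.
rewrite (linear_comb _ _ (compm_linl _)) (linear_comb _ _ (compm_linr _)).
by under eq_bigr do rewrite nat_natural.
Qed.

Lemma Nat_tensor_unit_neq0 (k : fieldType) (C D : tensorCat k)
    (F G : tensorFunctor C D) (eta : Nat_tensor F G) : eta (tunit C) <> 0.
Proof.
move=> eta0; have := nat_unit eta.
rewrite eta0 (linear_fun0 (compm_linl _)) => G0.
have [V [VK _]] := tensor_fun0_iso G.
apply: (simple_id_neq0 (tensor_simple_unit D)).
by rewrite -VK -G0 (linear_fun0 (compm_linr _)).
Qed.

(** In a relation whose first coefficient is nonzero, the first transformation
    is a combination of the others, which are independent by induction; the
    values at P (x) P, where these combinations become quadratic, force every
    coefficient of it to vanish, and a transformation that is zero is excluded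
    by its value at the unit. *)
Lemma Nat_tensor_indep (k : closedFieldType) (C D : tensorCat k)
    (F G : tensorFunctor C D) (P : C) (n : nat)
    (eta : 'I_n -> Nat_tensor F G) :
  right_exact F -> fin_generator P -> injective eta ->
  lin_indep (fun i => eta i P).
Proof.
move=> F_rex P_gen; elim: n eta => [|n IHn] eta eta_inj; first by move=> c _ [].
pose eta' i := eta (lift ord0 i).
have eta'_indep : lin_indep (fun i => eta' i P).
  by apply: IHn => i j /eta_inj /lift_inj.
move=> c; rewrite big_ord_recl => rel.
case: (eqVneq (c ord0) 0) => [c00|c0_nz].
  move: rel; rewrite c00 scale0r add0r => rel i.
  by case: (unliftP ord0 i) => [j|] -> //; apply: (eta'_indep _ rel).
pose d i := - (c ord0)^-1 * c (lift ord0 i).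
(* If c ord0 is nonzero, the first transformation is a combination of the
   others, which are independent. *)
have relP : eta ord0 P = \sum_i d i *: eta' i P.
  under eq_bigr do rewrite -scalerA.
  rewrite -scaler_sumr (_ : \sum_i _ = - (c ord0 *: eta ord0 P)).
    by rewrite scaleNr scalerN opprK scalerA mulVf // scale1r.
  by apply/eqP; rewrite -addr_eq0 addrC rel.
have relX := Nat_tensor_comb_generator F_rex P_gen relP.
have rel_tens : \sum_i (eta' i P \oxm (d i *: (eta' i P - eta ord0 P))) = 0.
  have := nat_tens (eta ord0) P P; rewrite relX.
  rewrite (linear_comb _ _ (compm_linl _)).
  under eq_bigr do rewrite nat_tens.
  rewrite -(linear_comb _ _ (compm_linr _)).
  move/(iso_mono (tensor_fun2_iso G P P)) => eq_tens.
  under eq_bigr do rewrite (linear_funZ _ _ (tensm_linr _))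
    (linear_funB _ _ (tensm_linr _)) scalerBr.
  rewrite sumrB eq_tens [X in X \oxm _]relP.
  by rewrite (linear_comb _ _ (tensm_linl _)) subrr.
have eta_P_inj i : eta' i P <> eta ord0 P.
  move=> eqP0; suff /eta_inj : eta (lift ord0 i) = eta ord0 by [].
  (* An equality at P is a relation with a single term of coefficient 1. *)
  pose one (_ : 'I_1) : k := 1; apply: Nat_tensor_ext => X.
  have := Nat_tensor_comb_generator (d := one) (eta := fun=> eta ord0)
            F_rex P_gen (eta0 := eta' i).
  by rewrite /one big_ord1 scale1r => /(_ eqP0 X); rewrite big_ord1 scale1r.
have d0 i : d i = 0.
  have /eqP := tensm_indep eta'_indep rel_tens i.
  by rewrite scaler_eq0 subr_eq0 => /orP[] /eqP // /eta_P_inj.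
case: (Nat_tensor_unit_neq0 (eta := eta ord0)).
by rewrite relX big1 // => i _; rewrite d0 scale0r.
Qed.

Theorem corollary1p2 (k : closedFieldType) (C D : tensorCat k)
    (C_finite : is_finite_cat C) (F G : tensorFunctor C D)
    (F_right_exact : right_exact F) (G_right_exact : right_exact G) :
  is_finite_type (Nat_tensor F G).
Proof.
have [P P_gen] := finite_cat_generator C_finite.
have [N bound] := lin_indep_bound (tensor_fin_hom (F P) (G P)).
apply: (bounded_injections_finite (N := N)) => n eta eta_inj.
exact: bound (Nat_tensor_indep F_right_exact P_gen eta_inj).
Qed.
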